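(* If a non-interactive bit-commitment scheme (with projective verification) is $\epsilon$-binding against non-adaptive adversaries, then it is $(2^{\frac12 q}\sqrt{\epsilon})$-binding against $q$-quantum-memory-bounded projective adversaries.
   Context: Registers are finite-dimensional; $\mathcal D(\mathcal H)$ is the set of density operators on $\mathcal H$. A bit-commitment scheme is non-interactive (with projective verification) if it has the following form. Commit: Alice (committer) sends a classical message $x$ and a quantum register $B$ to Bob. Opening to $b\in\{0,1\}$: Alice sends a classical opening $y_b$ (from a finite set of possible openings to $b$) to Bob, and Bob applies a binary-outcome projective measurement $\{\mathbb V_{x,y_b},\mathrm{id}-\mathbb V_{x,y_b}\}$ to register $B$, where $\mathbb V_{x,y_b}$ (an orthogonal projector) corresponds to accepting. The scheme is $\epsilon$-binding against $q$-quantum-memory-bounded ($q$-QMB) projective adversaries if for all states $\rho_{AB}\in\mathcal D(\mathcal H_A\otimes\mathcal H_B)$ with $\dim(\mathcal H_A)\le 2^q$ and all classical messages $x$, $$P_0^A(\rho_{AB})+P_1^A(\rho_{AB})\le 1+\epsilon,\qquad P_b^A(\rho_{AB}):=\max_{\{\mathbb F_{y_b}\}_{y_b}}\sum_{y_b}\mathrm{tr}\bigl((\mathbb F_{y_b}\otimes\mathbb V_{x,y_b})\rho_{AB}\bigr),$$ where the maximum is over all projective measurements $\{\mathbb F_{y_b}\}_{y_b}$ on $A$ (mutually orthogonal projectors summing to the identity), indexed by the openings $y_b$ to $b$. It is $\epsilon$-binding against non-adaptive adversaries if this holds for $q=0$, i.e. if for all states $\rho_B\in\mathcal D(\mathcal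 H_B)$ and all $x$, $\max_{y_0}\mathrm{tr}(\mathbb V_{x,y_0}\rho_B)+\max_{y_1}\mathrm{tr}(\mathbb V_{x,y_1}\rho_B)\le 1+\epsilon$. *)

(* Defs.v *)
From mathcomp Require Import all_boot all_order all_algebra.
From mathcomp Require Import sesquilinear spectral complex mxtens.
From mathcomp Require Import boolp classical_sets reals exp.

Set Implicit Arguments.
Unset Strict Implicit.
Unset Printing Implicit Defensive.

Import Order.TTheory GRing.Theory Num.Theory.

Local Open Scope ring_scope.
Local Open Scope classical_set_scope.
Local Open Scope sesquilinear_scope.

Section Operators.
Variables (R : realType) (n : nat).
Implicit Types P rho : 'M[R[i]]_n.

Definition psdmx P : Prop :=
  P \is hermsymmx /\ forall v : 'cV[R[i]]_n, 0 <= (v ^t* *m P *m v) 0 0.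

Definition density rho : Prop := psdmx rho /\ \tr rho = 1.

Definition projector P : Prop := P \is hermsymmx /\ P *m P = P.

Definition proj_measurement (Y : finType) (F : Y -> 'M[R[i]]_n) : Prop :=
  [/\ forall y, projector (F y),
      forall y z, y != z -> F y *m F z = 0
    & \sum_y F y = 1%:M].

End Operators.

(* The single Hilbert space C^dimB is the register B. [verif x b y] is the
   projector that corresponds to acceptance of the opening y to b after the
   commit message x; the other outcome is its complement. *)
Record nibc_scheme (R : realType) := NIBCScheme {
  message : Type;
  opening : bool -> finType;
  dimB : nat;
  verif : message -> forall b, opening b -> 'M[R[i]]_dimB;
  verif_projector : forall x b (y : opening b), projector (verif x y)
}.

Section Binding.
Variables (R : realType) (S : nibc_scheme R).

(* The trace is a real number; [Re] only changes its type. *)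
Definition accept_prob (x : message S) (b : bool) (a : nat)
    (rho : 'M[R[i]]_(a * dimB S)) (F : opening S b -> 'M[R[i]]_a) : R :=
  complex.Re (\sum_y \tr ((F y *t verif x y) *m rho)).

(* P_b^A(rho_AB). The supremum is a maximum, by compactness of the set of
   projective measurements; if there is no opening to b, it is 0. *)
Definition adaptive_prob (x : message S) (b : bool) (a : nat)
    (rho : 'M[R[i]]_(a * dimB S)) : R :=
  sup [set accept_prob x rho F |
        F in [set F : opening S b -> 'M[R[i]]_a | proj_measurement F]].

Definition qmb_binding (q : nat) (eps : R) : Prop :=
  forall (a : nat) (rho : 'M[R[i]]_(a * dimB S)) (x : message S),
    (a <= 2 ^ q)%N -> density rho ->
    adaptive_prob x false rho + adaptive_prob x true rho <= 1 + eps.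

(* The maximum over the openings y to b of tr(V_{x,y} rho_B); these traces are
   nonnegative, so the default value 0 matters only without openings to b. *)
Definition nonadaptive_prob (x : message S) (b : bool)
    (rho : 'M[R[i]]_(dimB S)) : R :=
  \big[Num.max/0]_(y : opening S b) complex.Re (\tr (verif x y *m rho)).

(* The case q = 0 of [qmb_binding]: if dim A = 1, then a projective measurement
   on A selects one opening. *)
Definition nonadaptive_binding (eps : R) : Prop :=
  forall (rho : 'M[R[i]]_(dimB S)) (x : message S), density rho ->
    nonadaptive_prob x false rho + nonadaptive_prob x true rho <= 1 + eps.

End Binding.

(* Main.v *)
(** Let [F], [G] be measurements on A, [d = dim A], [P = sum_y F_y (x) V_y] and
    [Q = sum_z G_z (x) W_z]; P and Q are projectors, since the [F_y], resp. the
    [G_z], are mutually orthogonal.  For a vector w with p = P w and r = Q w,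
    expanding |(1+s) w - p - r|^2 >= 0 shows that <w,Pw> + <w,Qw> <= (1+s) |w|^2
    as soon as 2 Re <p,r> <= s (|p|^2 + |r|^2), which always holds for s = 1.

    Non-adaptive binding, tested on the vector |v| u + |u| v, gives
    Re <u,v> <= eps |u| |v| for u in the range of V_y and v in the range of W_z.
    With p_y = (F_y (x) V_y) w and r_z = (G_z (x) W_z) w one has
    <p_y,r_z> = <p_y, (F_y G_z (x) 1) r_z>, hence
    Re <p,r> <= eps sum_yz |p_y| |r_z| |F_y G_z|, where |F_y G_z| is the
    Hilbert-Schmidt norm; as sum_yz |F_y G_z|^2 = tr 1 = d, Cauchy-Schwarz gives
    Re <p,r> <= eps sqrt d |p| |r|.  So s may be min(1, eps sqrt d), which is at
    most sqrt (d eps) <= 2^(q/2) sqrt eps. *)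

From HB Require Import structures.
Require Import Defs.
From mathcomp Require Import all_boot all_order all_algebra.
From mathcomp Require Import reals exp.
From mathcomp Require Import sesquilinear spectral complex mxtens ring lra.
From mathcomp Require Import classical_sets.

Set Implicit Arguments.
Unset Strict Implicit.
Unset Printing Implicit Defensive.

Import Order.TTheory GRing.Theory Num.Theory.
Local Open Scope ring_scope.
Local Open Scope sesquilinear_scope.

(** * Scalar inequalities *)

(** The quadratic is evaluated at its minimum [b / a]; if [a = 0], a nonnegative affine function
    must have slope 0. *)
Lemma sqr_le_discriminant (R : realFieldType) (a b c : R) :
  0 <= a -> (forall t, 0 <= a * t ^+ 2 - 2 * b * t + c) -> b ^+ 2 <= a * c.
Proof.
rewrite le_eqVlt => /predU1P[<- h|a_gt0 h].
  have [->|b0] := eqVneq b 0; first by rewrite expr0n mul0r.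
  (* At this point the affine function would take the value -1. *)
  have := h ((c + 1) / (2 * b)).
  suff -> : 0 * ((c + 1) / (2 * b)) ^+ 2 - 2 * b * ((c + 1) / (2 * b)) + c = -1.
    by lra.
  by field.
have := h (b / a).
have -> : a * (b / a) ^+ 2 - 2 * b * (b / a) + c = (a * c - b ^+ 2) / a.
  by field; rewrite gt_eqF.
by rewrite pmulr_lge0 ?invr_gt0// subr_ge0.
Qed.

Lemma sum_mul_sqr_le (R : realFieldType) (I : finType) (x y : I -> R) :
  (\sum_i x i * y i) ^+ 2 <= (\sum_i x i ^+ 2) * \sum_i y i ^+ 2.
Proof.
apply: sqr_le_discriminant => [|t].
  by rewrite sumr_ge0// => i; rewrite sqr_ge0.
have -> : (\sum_i x i ^+ 2) * t ^+ 2 - 2 * (\sum_i x i * y i) * t +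
    \sum_i y i ^+ 2 = \sum_i (x i * t - y i) ^+ 2.
  rewrite mulr_sumr !mulr_suml -sumrB -big_split/=.
  by apply: eq_bigr => i _; ring.
by rewrite sumr_ge0// => i; rewrite sqr_ge0.
Qed.

(** Serves [rdot_ranges_le] with [c] = |u| |v| and [t] = Re <u,v>: a positive [c + t] can be
    cancelled, and otherwise [t] is negative. *)
Lemma le_mul_of_sqr_le (R : realFieldType) (e c t : R) : 0 <= e -> 0 < c ->
  2 * (c + t) ^+ 2 <= (1 + e) * (2 * c * (c + t)) -> t <= e * c.
Proof.
move=> e0 c0 h; have [ct|ct] := leP (c + t) 0.
  by have := mulr_ge0 e0 (ltW c0); lra.
have : (c + t) * (c + t) <= (c + t) * ((1 + e) * c) by lra.
by rewrite ler_pM2l//; lra.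
Qed.

(* The real part makes 'M[R[i]]_(m, n) a Euclidean space over R.  Locked:
   otherwise unification unfolds the traces. *)
HB.lock Definition rdot (R : realType) m n (X Y : 'M[R[i]]_(m, n)) : R :=
  complex.Re (\tr (X ^t* *m Y)).

(** * The real Hilbert-Schmidt inner product and its norm *)

Section HilbertSchmidt.
Variable R : realType.
Local Notation C := R[i].

Lemma complexReD (x y : C) : complex.Re (x + y) = complex.Re x + complex.Re y.
Proof. by case: x y => [? ?] [? ?]. Qed.

Lemma complexReN (x : C) : complex.Re (- x) = - complex.Re x.
Proof. by case: x => [? ?]. Qed.

Lemma complexReZ (r : R) (x : C) : complex.Re (r%:C%C * x) = r * complex.Re x.
Proof. by case: x => [? ?] /=; rewrite mul0r subr0. Qed.

Lemma complexRe_conj (x : C) : complex.Re (x^*) = complex.Re x.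
Proof. by case: x. Qed.

Lemma complexRe_le (x y : C) : x <= y -> complex.Re x <= complex.Re y.
Proof. by rewrite lecE => /andP[]. Qed.

Lemma complexRe_sum (I : finType) (F : I -> C) :
  complex.Re (\sum_i F i) = \sum_i complex.Re (F i).
Proof. by elim/big_ind2: _ => // ? ? ? ? <- <-; rewrite complexReD. Qed.

Definition rnorm m n (X : 'M[C]_(m, n)) : R := Num.sqrt (rdot X X).

Lemma adjM m n p (X : 'M[C]_(m, n)) (Y : 'M[C]_(n, p)) :
  (X *m Y) ^t* = Y ^t* *m X ^t*.
Proof. by rewrite trmx_mul map_mxM. Qed.

Lemma rdotC m n (X Y : 'M[C]_(m, n)) : rdot X Y = rdot Y X.
Proof.
rewrite !rdot.unlock -[LHS]complexRe_conj -mxtrace_tr.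
have -> : (\tr (X ^t* *m Y)^T)^* = \tr ((X ^t* *m Y)^t*) .
  by rewrite /mxtrace rmorph_sum/=; apply: eq_bigr => i _; rewrite [in RHS]mxE.
by rewrite adjM trmxCK.
Qed.

Lemma rdotDr m n (X Y Z : 'M[C]_(m, n)) : rdot X (Y + Z) = rdot X Y + rdot X Z.
Proof. by rewrite !rdot.unlock mulmxDr raddfD/= complexReD. Qed.

Lemma rdotDl m n (X Y Z : 'M[C]_(m, n)) : rdot (X + Y) Z = rdot X Z + rdot Y Z.
Proof. by rewrite rdotC rdotDr !(rdotC Z). Qed.

Lemma rdotNr m n (X Y : 'M[C]_(m, n)) : rdot X (- Y) = - rdot X Y.
Proof. by rewrite !rdot.unlock mulmxN raddfN/= complexReN. Qed.

Lemma rdotNl m n (X Y : 'M[C]_(m, n)) : rdot (- X) Y = - rdot X Y.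
Proof. by rewrite rdotC rdotNr rdotC. Qed.

Lemma rdotZr m n r (X Y : 'M[C]_(m, n)) : rdot X (r%:C%C *: Y) = r * rdot X Y.
Proof. by rewrite !rdot.unlock -scalemxAr linearZ/= complexReZ. Qed.

Lemma rdotZl m n r (X Y : 'M[C]_(m, n)) : rdot (r%:C%C *: X) Y = r * rdot X Y.
Proof. by rewrite rdotC rdotZr rdotC. Qed.

Lemma rdot0r m n (X : 'M[C]_(m, n)) : rdot X 0 = 0.
Proof. by rewrite !rdot.unlock mulmx0 raddf0. Qed.

Lemma rdot_sumr m n (I : finType) (X : 'M[C]_(m, n)) (Y : I -> 'M[C]_(m, n)) :
  rdot X (\sum_i Y i) = \sum_i rdot X (Y i).
Proof.
by rewrite !rdot.unlock mulmx_sumr (raddf_sum (@mxtrace C n)) complexRe_sum.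
Qed.

Lemma rdot_suml m n (I : finType) (X : 'M[C]_(m, n)) (Y : I -> 'M[C]_(m, n)) :
  rdot (\sum_i Y i) X = \sum_i rdot (Y i) X.
Proof. by rewrite rdotC rdot_sumr; apply: eq_bigr => i _; rewrite rdotC. Qed.

Lemma rdot_mull m n p (A : 'M[C]_(m, n)) (X : 'M[C]_(n, p)) Y :
  rdot (A *m X) Y = rdot X (A ^t* *m Y).
Proof. by rewrite !rdot.unlock adjM mulmxA. Qed.

Lemma rdot_mulr m n p (A : 'M[C]_(n, p)) (X : 'M[C]_(m, n)) Y :
  rdot (X *m A) Y = rdot X (Y *m A ^t*).
Proof. by rewrite !rdot.unlock adjM -mulmxA mxtrace_mulC mulmxA. Qed.

Lemma rdot_sqE m n (X : 'M[C]_(m, n)) :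
  rdot X X = complex.Re (\sum_i \sum_j `|X i j| ^+ 2).
Proof.
rewrite !rdot.unlock; congr complex.Re; rewrite exchange_big/=.
apply: eq_bigr => j _; rewrite !mxE; apply: eq_bigr => i _.
by rewrite !mxE normCK mulrC.
Qed.

Lemma rdot_ge0 m n (X : 'M[C]_(m, n)) : 0 <= rdot X X.
Proof.
rewrite rdot_sqE; apply: (@complexRe_le 0).
by do 2![apply: sumr_ge0 => ? _]; rewrite exprn_ge0.
Qed.

Lemma rnorm_ge0 m n (X : 'M[C]_(m, n)) : 0 <= rnorm X.
Proof. exact: sqrtr_ge0. Qed.

Lemma sqr_rnorm m n (X : 'M[C]_(m, n)) : rnorm X ^+ 2 = rdot X X.
Proof. by rewrite sqr_sqrtr// rdot_ge0. Qed.

Lemma rdot_CauchySchwarz m n (X Y : 'M[C]_(m, n)) :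
  rdot X Y ^+ 2 <= rdot X X * rdot Y Y.
Proof.
apply: sqr_le_discriminant => [|t]; first exact: rdot_ge0.
have := rdot_ge0 (t%:C%C *: X - Y).
rewrite rdotDl !rdotDr !rdotNr !rdotNl !rdotZl !rdotZr (rdotC Y X).
by congr (0 <= _); ring.
Qed.

(** Each entry of [X *m M] is the inner product of a row of [X] with a conjugated column of [M]; the
    entrywise Cauchy-Schwarz bounds, summed over both indices, factor. *)
Lemma rdot_submul m n p (X : 'M[C]_(m, n)) (M : 'M[C]_(n, p)) :
  rdot (X *m M) (X *m M) <= rdot X X * rdot M M.
Proof.
have -> : rdot M M = complex.Re (\sum_j \sum_i `|M i j| ^+ 2).
  by rewrite rdot_sqE exchange_big.
rewrite !rdot_sqE.
set x := \sum_i _; set y := \sum_j _; set z := \sum_i _.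
have y0 : 0 <= y.
  by do 2![apply: sumr_ge0 => ? _]; rewrite exprn_ge0.
(* [y] is real, being nonnegative, so [Re] is multiplicative here. *)
have -> : complex.Re y * complex.Re z = complex.Re (y * z).
  move: y0; case: (y) => a b; case: (z) => c d /=.
  by rewrite lecE/= => /andP[/eqP-> _]; rewrite mul0r subr0.
apply: complexRe_le; rewrite mulr_suml; apply: ler_sum => i _.
rewrite mulr_sumr; apply: ler_sum => j _.
pose u := row i X; pose v := (col j M)^t*.
have : `|dotmx u v| ^+ 2 <= dotmx u u * dotmx v v.
  by case: (CauchySchwarz (@dotmx C n) u v).
rewrite !dotmxE trmxCK => h.
apply: (le_trans _ (le_trans h _)).
  by rewrite !mxE; under [in leRHS]eq_bigr => k _ do rewrite !mxE.
rewrite !mxE le_eqVlt; apply/orP; left; apply/eqP; congr (_ * _).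
  by apply: eq_bigr => k _; rewrite !mxE normCK.
by apply: eq_bigr => k _; rewrite !mxE normCK mulrC.
Qed.

Lemma rdot_le_rnorm m n (X Y : 'M[C]_(m, n)) : rdot X Y <= rnorm X * rnorm Y.
Proof.
apply: (le_trans (ler_norm _)).
rewrite -(@ler_pXn2r _ 2)// ?nnegrE ?mulr_ge0 ?rnorm_ge0// exprMn !sqr_rnorm.
by rewrite real_normK ?num_real// rdot_CauchySchwarz.
Qed.

Lemma rnorm_submul m n p (X : 'M[C]_(m, n)) (M : 'M[C]_(n, p)) :
  rnorm (X *m M) <= rnorm X * rnorm M.
Proof.
rewrite -(@ler_pXn2r _ 2)// ?nnegrE ?mulr_ge0 ?rnorm_ge0// exprMn !sqr_rnorm.
exact: rdot_submul.
Qed.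

(** * Projectors and their ranges *)

Lemma projector_adj n (P : 'M[C]_n) : projector P -> P ^t* = P.
Proof. by case=> /is_hermitianmxP; rewrite expr0 scale1r => <-. Qed.

(** Transposes enter because [F *t V] acts on matrices as X |-> V X F^T. *)
Lemma projector_trmx n (P : 'M[C]_n) : projector P -> projector P^T.
Proof.
move=> Pp; have [_ PP] := Pp; split; last by rewrite -trmx_mul PP.
by apply/is_hermitianmxP; rewrite expr0 scale1r -{1}(projector_adj Pp) map_trmx.
Qed.

Lemma proj_measurement_trmx n (Y : finType) (F : Y -> 'M[C]_n) :
  proj_measurement F -> proj_measurement (fun y => (F y)^T).
Proof.
case=> Fp F0 F1; split=> [y|y z yz|].
- exact: projector_trmx.
- by rewrite -trmx_mul F0 ?trmx0// eq_sym.
- by rewrite -raddf_sum/= F1 trmx1.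
Qed.

Lemma rdot_projector n k (P : 'M[C]_n) (X : 'M[C]_(n, k)) :
  projector P -> rdot (P *m X) (P *m X) = rdot X (P *m X).
Proof.
by move=> Pp; rewrite rdot_mull (projector_adj Pp) mulmxA (proj2 Pp).
Qed.

(** The two summands of the test vector [w] have equal length, so |w|^2 = 2 |u| |v| (|u| |v| +
    <u,v>), while <w,Pw> and <w,Qw> are both at least (|u| |v| + <u,v>)^2. *)
Lemma rdot_ranges_le n k (P Q : 'M[C]_n) (e : R) (u v : 'M[C]_(n, k)) :
  projector P -> projector Q -> 0 <= e ->
  (forall X : 'M[C]_(n, k),
     rdot X (P *m X) + rdot X (Q *m X) <= (1 + e) * rdot X X) ->
  P *m u = u -> Q *m v = v -> rdot u v <= e * (rnorm u * rnorm v).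
Proof.
move=> Pp Qp e0 H Pu Qv.
have := rnorm_ge0 u; rewrite le_eqVlt => /predU1P[u0|u0].
  by have := rdot_le_rnorm u v; rewrite -u0 mul0r mulr0.
have := rnorm_ge0 v; rewrite le_eqVlt => /predU1P[v0|v0].
  by have := rdot_le_rnorm u v; rewrite -v0 !mulr0.
set a := rnorm u in u0 *; set b := rnorm v in v0 *; set t := rdot u v.
pose w := b%:C%C *: u + a%:C%C *: v.
(* As [T] fixes [x], <x,w> = <x,Tw>; moreover |Tw|^2 = <w,Tw>. *)
have wP (T : 'M[C]_n) (x : 'M[C]_(n, k)) : projector T -> T *m x = x ->
    rdot x w ^+ 2 <= rdot x x * rdot w (T *m w).
  move=> Tp Tx; rewrite -{1}Tx rdot_mull projector_adj// -rdot_projector//.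
  exact: rdot_CauchySchwarz.
have rdotuu : rdot u u = a ^+ 2 by rewrite sqr_rnorm.
have rdotvv : rdot v v = b ^+ 2 by rewrite sqr_rnorm.
have uw : rdot u w = a * (a * b + t) by rewrite rdotDr !rdotZr rdotuu -/t; ring.
have vw : rdot v w = b * (a * b + t).
  by rewrite rdotDr !rdotZr rdotvv (rdotC v) -/t; ring.
have ww : rdot w w = 2 * (a * b) * (a * b + t).
  by rewrite {1}rdotDl !rdotZl uw vw; ring.
have : (a * b + t) ^+ 2 <= rdot w (P *m w).
  have := wP _ _ Pp Pu; rewrite uw rdotuu exprMn ler_pM2l// exprn_gt0//.
have : (a * b + t) ^+ 2 <= rdot w (Q *m w).
  have := wP _ _ Qp Qv; rewrite vw rdotvv exprMn ler_pM2l// exprn_gt0//.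
have := H w; rewrite ww.
have ab0 : 0 < a * b by rewrite mulr_gt0.
move=> wH wQ wP'; apply: le_mul_of_sqr_le => //.
by apply: le_trans wH; rewrite mulr2n mulrDl !mul1r lerD.
Qed.

Lemma rdot_two_projections_le m n (s : R) (X p r : 'M[C]_(m, n)) : 0 <= s ->
  rdot X p = rdot p p -> rdot X r = rdot r r ->
  2 * rdot p r <= s * (rdot p p + rdot r r) ->
  rdot X p + rdot X r <= (1 + s) * rdot X X.
Proof.
move=> s0 Xp Xr pr.
have s1 : 0 < 1 + s by rewrite ltr_pwDl.
(* After multiplication by 1 + s, the difference of the two sides is |(1+s) X - p - r|^2 + s (|p|^2
   + |r|^2) - 2 <p,r>. *)
rewrite -(ler_pM2l s1) -subr_ge0.
have := rdot_ge0 ((1 + s)%:C%C *: X - (p + r)).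
rewrite rdotDl !rdotDr !rdotNr !rdotNl !rdotZl !rdotZr !rdotDl !rdotDr.
rewrite (rdotC p X) (rdotC r X) (rdotC r p) Xp Xr => h.
by apply: (le_trans h); move: pr; lra.
Qed.

(** * Joint measurement operators in matrix form *)

Section Opening.
Variables (a b : nat).

(** In terms of [unvec], this is sum_y F_y^T (x) V_y applied to the vector of [X]. *)
Definition opening_op (Y : finType) (V : Y -> 'M[C]_b) (F : Y -> 'M[C]_a)
    (X : 'M[C]_(b, a)) :=
  \sum_y V y *m X *m F y.

Section One.
Variables (Y : finType) (V : Y -> 'M[C]_b) (F : Y -> 'M[C]_a).
Hypotheses (Vp : forall y, projector (V y)) (Fm : proj_measurement F).
Variable X : 'M[C]_(b, a).

(** Pythagoras: a cross term contains [F z *m F y], which is 0. *)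
Lemma opening_op_sumsq :
  rdot (opening_op V F X) (opening_op V F X) =
  \sum_y rdot (V y *m X *m F y) (V y *m X *m F y).
Proof.
have [Fp F0 _] := Fm.
rewrite rdot_suml; apply: eq_bigr => y _.
rewrite rdot_sumr (bigD1 y)//= big1 ?addr0// => z zy.
by rewrite rdot_mulr projector_adj// -!mulmxA F0// !mulmx0 rdot0r.
Qed.

Lemma rdot_opening_op :
  rdot X (opening_op V F X) = rdot (opening_op V F X) (opening_op V F X).
Proof.
have [Fp _ _] := Fm.
rewrite opening_op_sumsq rdot_sumr; apply: eq_bigr => y _.
rewrite rdot_mulr projector_adj// rdot_mull projector_adj//.
by rewrite !mulmxA (proj2 (Vp y)) -(mulmxA _ (F y)) (proj2 (Fp y)).
Qed.

End One.

Lemma rdot_opening_op_le (Y Z : finType) (e : R)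
    (V : Y -> 'M[C]_b) (F : Y -> 'M[C]_a)
    (W : Z -> 'M[C]_b) (G : Z -> 'M[C]_a) X :
  0 <= e ->
  (forall y, projector (V y)) -> (forall z, projector (W z)) ->
  proj_measurement F -> proj_measurement G ->
  (forall y z (u v : 'M[C]_(b, a)),
     V y *m u = u -> W z *m v = v -> rdot u v <= e * (rnorm u * rnorm v)) ->
  rdot (opening_op V F X) (opening_op W G X) <=
  e * Num.sqrt a%:R * (rnorm (opening_op V F X) * rnorm (opening_op W G X)).
Proof.
move=> e0 Vp Wp Fm Gm VW; have [Fp _ F1] := Fm; have [Gp _ G1] := Gm.
pose p y := V y *m X *m F y; pose r z := W z *m X *m G z.
have rdotM y z :
    rdot (p y) (r z) <= e * ((rnorm (p y) * rnorm (r z)) * rnorm (G z *m F y)).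
  (* By idempotence, a copy of [F y] moves to the other side. The new factor acts on the right, so
     the result stays in the range of [W z]. *)
  have -> : rdot (p y) (r z) = rdot (p y) (r z *m (G z *m F y)).
    rewrite /p /r -{1}(proj2 (Fp y)) -{1}(proj2 (Gp z)) !mulmxA.
    by rewrite rdot_mulr projector_adj.
  apply: le_trans (VW y z _ _ _ _) _.
  - by rewrite /p !mulmxA (proj2 (Vp y)).
  - by rewrite /r !mulmxA (proj2 (Wp z)).
  by rewrite ler_wpM2l// -mulrA ler_wpM2l ?rnorm_ge0// rnorm_submul.
(* For fixed y, |G_z F_y|^2 = <F_y, G_z F_y>, which sums over z to tr F_y; these traces sum to tr
   1. *)
have sumGF : \sum_(yz : Y * Z) rnorm (G yz.2 *m F yz.1) ^+ 2 = a%:R.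
  rewrite -(pair_bigA _ (fun y z => rnorm (G z *m F y) ^+ 2))/=.
  transitivity (\sum_y complex.Re (\tr (F y))).
    apply: eq_bigr => y _.
    under eq_bigr => z _ do rewrite sqr_rnorm rdot_projector//.
    rewrite -rdot_sumr -mulmx_suml G1 mul1mx rdot.unlock projector_adj//.
    by rewrite (proj2 (Fp y)).
  rewrite -complexRe_sum -(raddf_sum (@mxtrace C a)) F1.
  transitivity (complex.Re (a%:R : C)).
    by congr complex.Re; exact: mxtrace1.
  by elim: a => // n IH; rewrite -!natr1 complexReD IH.
rewrite -mulrA {1}/opening_op rdot_suml.
under eq_bigr => y _ do rewrite rdot_sumr.
apply: (@le_trans _ _ (e * \sum_(yz : Y * Z)
   ((rnorm (p yz.1) * rnorm (r yz.2)) * rnorm (G yz.2 *m F yz.1)))).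
  rewrite mulr_sumr pair_bigA/=; apply: ler_sum => -[y z] _; exact: rdotM.
rewrite ler_wpM2l//.
rewrite -(@ler_pXn2r _ 2)// ?nnegrE; last 2 first.
- by rewrite sumr_ge0// => -[y z] _; rewrite !mulr_ge0 ?rnorm_ge0.
- by rewrite !mulr_ge0 ?rnorm_ge0 ?sqrtr_ge0.
(* Cauchy-Schwarz over the pairs (y,z), with |p_y| |r_z| against |G_z F_y|; the squares of the
   former sum to |p|^2 |r|^2. *)
apply: le_trans (sum_mul_sqr_le _ _) _.
rewrite sumGF 2!exprMn !sqr_rnorm sqr_sqrtr// mulrC ler_wpM2l//.
rewrite !opening_op_sumsq// mulr_suml.
rewrite -(pair_bigA _ (fun y z => (rnorm (p y) * rnorm (r z)) ^+ 2))/=.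
apply: ler_sum => y _; rewrite mulr_sumr; apply: ler_sum => z _.
by rewrite exprMn !sqr_rnorm.
Qed.

End Opening.

(** * Positive operators: from states to vectors *)

Lemma tr_gram m n (X : 'M[C]_(m, n)) : \tr (X ^t* *m X) = (rdot X X)%:C%C.
Proof.
rewrite rdot.unlock [LHS]complexE ger0_Im ?mulr0 ?addr0// /mxtrace.
apply: sumr_ge0 => j _; rewrite mxE sumr_ge0// => i _.
by rewrite !mxE mulrC -normCK exprn_ge0.
Qed.

Lemma psdmx_gram m n (r : R) (X : 'M[C]_(m, n)) :
  0 <= r -> psdmx (r%:C%C *: (X *m X ^t*)).
Proof.
move=> r0; split.
  apply/is_hermitianmxP; rewrite expr0 scale1r linearZ/= map_mxZ/=.
  by rewrite [in RHS]adjM trmxCK; congr (_ *: _); exact/esym/conjc_real.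
move=> v; rewrite -scalemxAr -scalemxAl mxE mulr_ge0 ?ler0c//.
have -> : v ^t* *m (X *m X ^t*) *m v = (X ^t* *m v) ^t* *m (X ^t* *m v).
  by rewrite adjM trmxCK !mulmxA.
by rewrite mxE sumr_ge0// => i _; rewrite !mxE mulrC -normCK exprn_ge0.
Qed.

(** In an orthonormal eigenbasis v_i of [rho], tr (M rho) = sum_i d_i <v_i, M v_i>, with eigenvalues
    d_i = <v_i, rho v_i> >= 0. *)
Lemma psdmx_tr_ge0 n (M rho : 'M[C]_n) : psdmx rho ->
  (forall w : 'cV[C]_n, 0 <= rdot w (M *m w)) ->
  0 <= complex.Re (\tr (M *m rho)).
Proof.
move=> [rhoH rho0] M0.
have /hermitian_normalmx /orthomx_spectralP := rhoH.
set P := spectralmx rho; set d := spectral_diag rho => rhoE.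
have PU : P \is unitarymx by exact: spectral_unitarymx.
rewrite invmx_unitary// in rhoE.
have PP : P *m P^t* = 1%:M by apply/unitarymxP.
pose v i := (row i P)^t*.
have dE i : d 0 i = (v i ^t* *m rho *m v i) 0 0.
  have -> : v i ^t* *m rho *m v i = row i P *m P ^t* *m diag_mx d *m (P *m v i).
    by rewrite /v trmxCK {1}rhoE !mulmxA.
  have -> : row i P *m P ^t* = row i 1%:M by rewrite -row_mul PP.
  have -> : P *m v i = (row i 1%:M) ^t*.
    by rewrite -[1%:M]PP row_mul adjM trmxCK.
  rewrite -row_mul mul1mx [RHS]mxE (bigD1 i)//= big1 ?addr0.
    by rewrite !mxE !eqxx mulr1n conjC1 mulr1.
  by move=> j ji; rewrite !mxE (eq_sym i) (negbTE ji) conjC0 mulr0.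
have -> : \tr (M *m rho) = \sum_i d 0 i * (v i ^t* *m (M *m v i)) 0 0.
  rewrite rhoE mulmxA mxtrace_mulC !mulmxA /mxtrace; apply: eq_bigr => i _.
  rewrite -mulmxA mulmxA mul_mx_diag mxE mulrC; congr (_ * _).
  rewrite /v trmxCK mulmxA -row_mul !mxE.
  by apply: eq_bigr => k _; rewrite !mxE.
rewrite complexRe_sum sumr_ge0// => i _.
have d0 : 0 <= d 0 i by rewrite dE rho0.
rewrite [d 0 i]complexE ger0_Im// mulr0 addr0 complexReZ mulr_ge0//.
  exact: (complexRe_le d0).
by have := M0 (v i); rewrite rdot.unlock /mxtrace big_ord1.
Qed.

(** Positivity of the trace for [c] 1 - [M], as tr rho = 1; it reduces bounds on mixed states to
    bounds on vectors. *)
Lemma density_tr_le n (M rho : 'M[C]_n) (c : R) : density rho ->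
  (forall w : 'cV[C]_n, rdot w (M *m w) <= c * rdot w w) ->
  complex.Re (\tr (M *m rho)) <= c.
Proof.
move=> [rhop rho1] Mc.
have := @psdmx_tr_ge0 _ (c%:C%C%:M - M) _ rhop.
rewrite mulmxBl mul_scalar_mx raddfB/= complexReD complexReN linearZ/=.
rewrite complexReZ rho1 mulr1 subr_ge0; apply => w.
by rewrite mulmxBl mul_scalar_mx rdotDr rdotNr rdotZr subr_ge0.
Qed.

(* Identifies a vector of A (x) B with a matrix X, on which F (x) V acts as
   X |-> V X F^T. *)
Definition unvec a b (w : 'cV[C]_(a * b)) : 'M[C]_(b, a) :=
  \matrix_(j, i) w (mxtens_index (i, j)) 0.

Lemma sum_mxtens a b (V : nmodType) (f : 'I_(a * b) -> V) :
  \sum_k f k = \sum_i \sum_j f (mxtens_index (i, j)).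
Proof.
rewrite pair_bigA/= (reindex (@mxtens_index a b))/=; last first.
  by exists (@mxtens_unindex a b) => ? _;
    rewrite (mxtens_indexK, mxtens_unindexK).
by apply: eq_bigr => -[].
Qed.

Lemma rdot_unvec a b (v w : 'cV[C]_(a * b)) :
  rdot (unvec v) (unvec w) = rdot v w.
Proof.
rewrite !rdot.unlock; congr complex.Re; rewrite /mxtrace big_ord1.
rewrite mxE sum_mxtens; apply: eq_bigr => i _; rewrite mxE.
by apply: eq_bigr => j _; rewrite !mxE.
Qed.

Lemma unvec_tens a b (F : 'M[C]_a) (V : 'M[C]_b) w :
  unvec ((F *t V) *m w) = V *m unvec w *m F^T.
Proof.
apply/matrixP => j i; rewrite !mxE sum_mxtens; apply: eq_bigr => k _.
rewrite !mxE mulr_suml; apply: eq_bigr => l _.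
by rewrite tensmxE !mxE; ring.
Qed.

Lemma rdot_tens_opening a b (Y : finType) (V : Y -> 'M[C]_b) (F : Y -> 'M[C]_a)
    w :
  rdot w ((\sum_y F y *t V y) *m w) =
  rdot (unvec w) (opening_op V (fun y => (F y)^T) (unvec w)).
Proof.
rewrite mulmx_suml !rdot_sumr; apply: eq_bigr => y _.
by rewrite -rdot_unvec unvec_tens.
Qed.

(** The [sup] of the empty set is 0, so the joint bound says nothing if [A] or [B] is empty; the
    separate bounds and [0 <= c] cover those cases. *)
Lemma sup_add_le (A B : set R) (c : R) :
  0 <= c -> (forall x, A x -> x <= c) -> (forall y, B y -> y <= c) ->
  (forall x y, A x -> B y -> x + y <= c) -> sup A + sup B <= c.
Proof.
move=> c0 Ac Bc ABc.
have [->|/set0P A0] := eqVneq A set0.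
  rewrite sup0 add0r; have [->|/set0P B0] := eqVneq B set0.
    by rewrite sup0.
  exact: ge_sup.
have [->|/set0P B0] := eqVneq B set0.
  by rewrite sup0 addr0; exact: ge_sup.
rewrite -lerBrDr; apply: ge_sup => // x Ax.
rewrite lerBrDr -lerBrDl; apply: ge_sup => // y By.
by rewrite lerBrDl; exact: ABc.
Qed.

(** * Bounds on the probabilities of a scheme *)

(** For nonzero [X], binding is tested on the state X X^* / |X|^2, the reduced state on B of the
    normalized [X]. *)
Lemma nonadaptive_binding_rdot (S : nibc_scheme R) (eps : R) (x : message S)
    (y : opening S false) (z : opening S true) k (X : 'M[C]_(dimB S, k)) :
  nonadaptive_binding S eps ->
  rdot X (verif x y *m X) + rdot X (verif x z *m X) <= (1 + eps) * rdot X X.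
Proof.
move=> H; have := rdot_ge0 X; rewrite le_eqVlt => /predU1P[X0|X0].
  have rdot0 Y : rdot X Y <= 0.
    by rewrite (le_trans (rdot_le_rnorm _ _))// /rnorm -X0 sqrtr0 mul0r.
  rewrite -X0 mulr0.
  by have := rdot0 (verif x y *m X); have := rdot0 (verif x z *m X); lra.
pose rho := ((rdot X X)^-1)%:C%C *: (X *m X ^t*).
have trE (V : 'M[C]_(dimB S)) :
    complex.Re (\tr (V *m rho)) = rdot X (V *m X) / rdot X X.
  rewrite [in rdot X (V *m X)]rdot.unlock -scalemxAr linearZ/= complexReZ.
  rewrite mulrC; congr (_ / _); by rewrite mulmxA mxtrace_mulC.
have rhoD : density rho.
  split; first by apply: psdmx_gram; rewrite invr_ge0 rdot_ge0.
  by rewrite linearZ/= mxtrace_mulC tr_gram -rmorphM/= mulVf ?gt_eqF.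
have := H rho x rhoD; rewrite /nonadaptive_prob.
have /= := @le_bigmax _ _ _ (0 : R)
  (fun y : opening S false => complex.Re (\tr (verif x y *m rho))) y.
have /= := @le_bigmax _ _ _ (0 : R)
  (fun y : opening S true => complex.Re (\tr (verif x y *m rho))) z.
rewrite !trE -ler_pdivrMr// mulrDl; lra.
Qed.

Lemma accept_probE (S : nibc_scheme R) (x : message S) b a rho
    (F : opening S b -> 'M[C]_a) :
  accept_prob x rho F = complex.Re (\tr ((\sum_y F y *t verif x y) *m rho)).
Proof. by rewrite mulmx_suml (raddf_sum (@mxtrace C _)). Qed.

(** The case s = 0, r = 0 of [rdot_two_projections_le]; it serves schemes without openings to one of
    the bits. *)
Lemma accept_prob_le1 (S : nibc_scheme R) (x : message S) b a rho
    (F : opening S b -> 'M[C]_a) :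
  density rho -> proj_measurement F -> accept_prob x rho F <= 1.
Proof.
move=> rhoD Fm; rewrite accept_probE; apply: density_tr_le => // w.
rewrite rdot_tens_opening -rdot_unvec mul1r.
set p := opening_op _ _ _.
have := @rdot_two_projections_le _ _ 0 (unvec w) p 0 (lexx _).
rewrite !rdot0r !addr0 !mulr0 !mul0r !mul1r; apply=> //.
apply: rdot_opening_op; last exact: proj_measurement_trmx.
by move=> y; exact: verif_projector.
Qed.

Lemma accept_prob_add_le (S : nibc_scheme R) (eps s : R) (x : message S) a rho
    (F : opening S false -> 'M[C]_a) (G : opening S true -> 'M[C]_a) :
  0 <= eps -> nonadaptive_binding S eps ->
  density rho -> proj_measurement F -> proj_measurement G ->
  0 <= s -> (1 <= s) || (eps * Num.sqrt a%:R <= s) ->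
  accept_prob x rho F + accept_prob x rho G <= 1 + s.
Proof.
move=> eps0 H rhoD /proj_measurement_trmx Fm /proj_measurement_trmx Gm s0 s1.
rewrite !accept_probE -complexReD -raddfD/= -mulmxDl.
apply: density_tr_le => // w.
rewrite mulmxDl rdotDr !rdot_tens_opening -rdot_unvec.
set X := unvec w; set p := opening_op _ _ _; set r := opening_op _ _ _.
have Vp b (y : opening S b) : projector (verif x y) by exact: verif_projector.
apply: rdot_two_projections_le => //; try exact: rdot_opening_op.
have h2 : 2 * (rnorm p * rnorm r) <= rdot p p + rdot r r.
  by have := sqr_ge0 (rnorm p - rnorm r); rewrite -!sqr_rnorm; lra.
have h0 : 0 <= rdot p p + rdot r r by rewrite addr_ge0// rdot_ge0.
(* For [1 <= s], Cauchy-Schwarz and [h2] suffice; otherwise binding bounds <p,r>. *)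
case/orP: s1 => s1.
  apply: (@le_trans _ _ (2 * (rnorm p * rnorm r))).
    by have := rdot_le_rnorm p r; lra.
  by apply: (le_trans h2); rewrite ler_peMl.
have := rdot_opening_op_le X eps0 (Vp _) (Vp _) Fm Gm => /(_ _)/wrap[].
  move=> y z u v; apply: rdot_ranges_le => // Z.
  exact: nonadaptive_binding_rdot.
rewrite -/p -/r => hpr.
apply: (@le_trans _ _ (s * (2 * (rnorm p * rnorm r)))); last by rewrite ler_wpM2l.
have := ler_wpM2r (mulr_ge0 (rnorm_ge0 p) (rnorm_ge0 r)) s1; lra.
Qed.

End HilbertSchmidt.

Theorem theorem5 (R : realType) (S : nibc_scheme R) (q : nat) (eps : R) :
  0 <= eps ->
  nonadaptive_binding S eps ->
  qmb_binding S q (2 `^ (2^-1 * q%:R) * Num.sqrt eps).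
Proof.
move=> eps0 H a rho x aq rhoD.
have -> : 2 `^ (2^-1 * q%:R) = Num.sqrt (2 ^+ q) :> R.
  by rewrite mulrC powRrM powR_mulrn// powR12_sqrt// exprn_ge0.
set s := _ * _.
have s0 : 0 <= s by rewrite mulr_ge0 ?sqrtr_ge0.
have s1 : (1 <= s) || (eps * Num.sqrt a%:R <= s).
  (* If [1 <= eps], both factors of [s] are at least 1; if [eps < 1], then eps <= sqrt eps, and a <=
     2^q. *)
  have [eps1|eps1] := leP 1 eps; apply/orP; [left|right].
    by rewrite -[1]mulr1 ler_pM// -{1}sqrtr1 ler_wsqrtr// exprn_ege1// ler1n.
  rewrite mulrC ler_pM ?sqrtr_ge0// ?ler_wsqrtr//.
    by rewrite -natrX ler_nat.
  rewrite -{1}(sqr_sqrtr eps0) expr2 ler_piMl ?sqrtr_ge0//.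
  by rewrite -sqrtr1 ler_wsqrtr// ltW.
apply: sup_add_le.
- by rewrite addr_ge0.
- by move=> _ [F Fm <-]; rewrite (le_trans (accept_prob_le1 _ rhoD Fm))// lerDl.
- by move=> _ [F Fm <-]; rewrite (le_trans (accept_prob_le1 _ rhoD Fm))// lerDl.
- move=> _ _ [F Fm <-] [G Gm <-].
  exact: accept_prob_add_le eps0 H rhoD Fm Gm _ _.
Qed.
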